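(* $\mathcal{D}(L_4,1)\le 2/9$.
   Context: $L_n$ denotes the $n$-dimensional lattice graph (here $n=4$): its vertex set is $\mathbb{Z}^n$, and $\{(x_1,\ldots,x_n),(y_1,\ldots,y_n)\}$ is an edge if and only if $\sum_{i=1}^n |x_i-y_i|=1$. For a connected undirected graph $G$ with graph distance $d$, put $B_r(v)=\{u\in V(G): d(u,v)\le r\}$. A code is a nonempty subset $C\subseteq V(G)$. A code $C$ is $r$-identifying if (1) $B_r(v)\cap C\neq\emptyset$ for all $v\in V(G)$, and (2) $B_r(u)\cap C\ne B_r(v)\cap C$ for all $u\neq v$ in $V(G)$. The density of a code $C$ in $L_n$ is $\limsup_{m\to\infty} |C\cap Q_m|/|Q_m|$, where $Q_m$ is the set of $(x_1,\ldots,x_n)\in\mathbb{Z}^n$ with $|x_i|\le m$ for all $i$. $\mathcal{D}(L_n,r)$ denotes the minimum possible density (the infimum over all $r$-identifying codes) of an $r$-identifying code for $L_n$; here $r=1$. *)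

(* Defs.v *)
From HB Require Import structures.
From mathcomp Require Import all_boot all_order all_algebra.
From mathcomp Require Import finmap.
From mathcomp Require Import all_classical all_reals all_analysis.

Set Implicit Arguments.
Unset Strict Implicit.
Unset Printing Implicit Defensive.

Import Order.TTheory GRing.Theory Num.Theory.

Local Open Scope classical_set_scope.
Local Open Scope ring_scope.

Section IdentifyingCodes.
Variables (V : choiceType) (e : rel V).

Definition walk (u v : V) (k : nat) : Prop :=
  exists p : seq V, [/\ path e u p, last u p = v & size p = k].

(* d(u, v) = k; stated as a relation, so that no value has to be invented for
   vertices in different components. *)
Definition graph_dist (u v : V) (k : nat) : Prop :=
  walk u v k /\ forall l, walk u v l -> (k <= l)%N.

Definition graph_ball (r : nat) (v : V) : set V :=
  [set u | exists2 k, graph_dist u v k & (k <= r)%N].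

Definition identifying_code (r : nat) (C : set V) : Prop :=
  [/\ C !=set0,
      forall v, graph_ball r v `&` C !=set0 &
      forall u v, u <> v -> graph_ball r u `&` C <> graph_ball r v `&` C].

End IdentifyingCodes.

Definition lattice_adj (n : nat) : rel {ffun 'I_n -> int} :=
  fun x y => (\sum_(i < n) absz (x i - y i)%R)%N == 1%N.

Definition box (n m : nat) : set {ffun 'I_n -> int} :=
  [set x : {ffun 'I_n -> int} | forall i, (absz (x i) <= m)%N].
Arguments box : clear implicits.

(* [fset_set] is meaningful on finite sets only. *)
Lemma finite_box (n m : nat) : finite_set (box n m).
Proof.
pose g (f : {ffun 'I_n -> 'I_(m + m).+1}) : {ffun 'I_n -> int} :=
  [ffun i => (f i)%:Z - m%:Z].
apply: (@sub_finite_set _ _ (g @` setT)); last first.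
  exact/finite_image/finite_finset.
move=> x xm; exists [ffun i => inord (absz (x i + m%:Z))] => //.
apply/ffunP => i; rewrite !ffunE; have := xm i.
rewrite -lez_nat abszE ler_norml => /andP[lo hi].
have x0 : 0 <= x i + m%:Z by rewrite -lerBlDr sub0r.
have xE : (absz (x i + m%:Z))%:Z = x i + m%:Z by rewrite gez0_abs.
rewrite inordK ?xE ?addrK// ltnS -lez_nat xE PoszD lerD2r//.
Qed.

Definition density (R : realType) (n : nat) (C : set {ffun 'I_n -> int}) :
    \bar R :=
  limn_esup (fun m => ((#|` fset_set (C `&` box n m)|)%:R /
                       (#|` fset_set (box n m)|)%:R)%:E).

Definition min_density (R : realType) (n r : nat) : \bar R :=
  ereal_inf [set density R C | C in identifying_code (@lattice_adj n) r].

(* Main.v *)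
Require Import Defs.
From mathcomp Require Import all_boot all_order all_algebra.
From mathcomp Require Import finmap zify lra.
From mathcomp Require Import all_classical all_reals all_analysis.

(* The code is the preimage of {0, 1, 2, 6} under the homomorphism
   (a, b, c, d) |-> a + 2 b + 6 c + 9 d from Z^4 to Z/18.  It meets every unit
   ball, so two vertices with the same trace of the code have a common
   codeword in their unit balls and differ by s - t with s, t in the unit ball
   of 0.  Whether the codewords separate such a pair depends only on the
   residue mod 18 of one vertex and on s, t, which leaves finitely many cases.
   As the first coordinate has weight 1, each line parallel to the first axis
   meets the code with period 18 and four codewords per period, whence the
   density 4/18. *)

Set Implicit Arguments.
Unset Strict Implicit.
Unset Printing Implicit Defensive.

Import Order.TTheory GRing.Theory Num.Theory.

Local Open Scope classical_set_scope.
Local Open Scope ring_scope.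

(** * Unit balls of the lattice in coordinates *)

Lemma graph_ball1 (V : choiceType) (e : rel V) (u v : V) :
  graph_ball e 1 v u <-> v = u \/ e u v.
Proof.
split=> [[k [[p [up lp <-]] _]]|].
  case: p up lp => [|w [|//]] /=; first by left.
  by rewrite andbT => uw <- _; right.
case: (eqVneq v u) => [-> _|vu [vu'|uv]]; last 2 first.
- by rewrite vu' eqxx in vu.
- exists 1%N => //; split=> [|[|l]//]; first by exists [:: v]; rewrite /= uv.
  by case=> p [_ + /size0nil p0]; rewrite p0 /= => uv'; rewrite uv' eqxx in vu.
by exists 0%N => //; split=> //; exists [::].
Qed.

Local Notation quad := (int * int * int * int)%type.

(** Quadruples, unlike finite functions, evaluate under [vm_compute], on which the finite checks
    rely. *)
Definition coords (x : {ffun 'I_4 -> int}) : quad :=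
  (x (inord 0), x (inord 1), x (inord 2), x (inord 3)).

Definition point (q : quad) : {ffun 'I_4 -> int} :=
  let: (a, b, c, d) := q in [ffun i : 'I_4 => nth 0 [:: a; b; c; d] i].

Lemma pointK : cancel point coords.
Proof. by case=> [[[a b] c] d]; rewrite /coords !ffunE !inordK. Qed.

Lemma coordsK : cancel coords point.
Proof.
move=> x; apply/ffunP => -[[|[|[|[|//]]]] i4];
  rewrite ffunE /=; congr (x _); exact/val_inj/inordK.
Qed.

Definition norm1 (q : quad) : nat :=
  let: (a, b, c, d) := q in (absz a + absz b + absz c + absz d)%N.

Lemma norm1_eq0 q : norm1 q = 0%N -> q = 0.
Proof. by case: q => [[[[[|a]|a] [[|b]|b]] [[|c]|c]] [[|d]|d]]. Qed.

Lemma lattice_adjE (x y : {ffun 'I_4 -> int}) :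
  lattice_adj x y = (norm1 (coords x - coords y) == 1%N).
Proof.
rewrite /lattice_adj !big_ord_recl big_ord0 addn0 !addnA; congr (_ == 1%N).
by rewrite /norm1 /=; do 3?congr (_ + _)%N; congr (absz (x _ - y _));
  apply/val_inj; rewrite /= inordK.
Qed.

Lemma lattice_ball1 x y :
  graph_ball (@lattice_adj 4) 1 y x <-> (norm1 (coords x - coords y)%R <= 1)%N.
Proof.
rewrite graph_ball1 lattice_adjE; split=> [[->|/eqP->//]|].
  by rewrite subrr.
rewrite leq_eqVlt ltnS leqn0 => /orP[xy|/eqP/norm1_eq0/eqP]; first by right.
by rewrite subr_eq0 => /eqP/(can_inj coordsK)->; left.
Qed.

Definition unit_ball : seq quad :=
  [:: 0; (1, 0, 0, 0); (-1, 0, 0, 0); (0, 1, 0, 0); (0, -1, 0, 0);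
      (0, 0, 1, 0); (0, 0, -1, 0); (0, 0, 0, 1); (0, 0, 0, -1)].

Lemma mem_unit_ball q : (q \in unit_ball) = (norm1 q <= 1)%N.
Proof.
apply/idP/idP => [|].
  by apply/allP: q; vm_compute.
(* Each coordinate is split into 0, 1, at least 2, -1 and at most -2, so that the norm bound and the
   membership evaluate. *)
by case: q => [[[[[|[|a]]|[|a]] [[|[|b]]|[|b]]] [[|[|c]]|[|c]]] [[|[|d]]|[|d]]].
Qed.

(** * The code and its identifying property *)

Definition phi (q : quad) : int :=
  let: (a, b, c, d) := q in a + 2 * b + 6 * c + 9 * d.

Lemma phiD p q : phi (p + q) = phi p + phi q.
Proof. by case: p q => [[[a b] c] d] [[[a' b'] c'] d'] /=; lia. Qed.

Definition marks : seq int := [:: 0; 1; 2; 6].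

Definition marked (z : int) : bool := (z %% 18)%Z \in marks.

Lemma marked_phiD u w :
  marked (phi (u + w)) = marked ((phi u %% 18)%Z + phi w).
Proof. by rewrite /marked modzDml phiD. Qed.

Lemma all_residues (P : pred int) (z : int) :
  all (fun g : nat => P g%:Z) (iota 0 18) -> P (z %% 18)%Z.
Proof.
have -> : (z %% 18)%Z = (absz (z %% 18)%Z)%:Z by lia.
by move=> /allP; apply; rewrite mem_iota; lia.
Qed.

Lemma marked_covers u : exists2 s, s \in unit_ball & marked (phi (u + s)).
Proof.
have /hasP[s sB] : has (fun s => marked ((phi u %% 18)%Z + phi s)) unit_ball.
  by apply: (@all_residues (fun g => has (fun s => marked (g + phi s)) _));
    vm_compute.
by rewrite -marked_phiD; exists s.
Qed.

(** Put [v = u + (s - t)]. The first alternative is a codeword [u + w] in the ball of [u] but not of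
    [v], the second a codeword [v + w] in the ball of [v] but not of [u]. *)
Lemma marked_separates u s t : s \in unit_ball -> t \in unit_ball -> s != t ->
  exists w, [/\ w \in unit_ball, w - (s - t) \notin unit_ball
                 & marked (phi (u + w))]
         \/ [/\ w \in unit_ball, w + (s - t) \notin unit_ball
                 & marked (phi (u + (s - t + w)))].
Proof.
move=> sB tB st.
pose sep g s t := has (fun w =>
  (w - (s - t) \notin unit_ball) && marked (g + phi w) ||
  (w + (s - t) \notin unit_ball) && marked (g + phi (s - t + w))) unit_ball.
have : all (fun s => all (fun t => (s != t) ==> sep (phi u %% 18)%Z s t)
  unit_ball) unit_ball.
  by apply: (@all_residues (fun g => all (fun s => all (fun t =>
    (s != t) ==> sep g s t) _) _)); vm_compute.
move=> /allP/(_ _ sB)/allP/(_ _ tB); rewrite st /= => /hasP[w wB].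
by rewrite -!marked_phiD => /orP[]/andP[]; exists w; [left|right].
Qed.

Definition code : set {ffun 'I_4 -> int} := [set x | marked (phi (coords x))].

Lemma code_ball_subset x y w :
  graph_ball (@lattice_adj 4) 1 x `&` code =
    graph_ball (@lattice_adj 4) 1 y `&` code ->
  w \in unit_ball -> marked (phi (coords x + w)) ->
  coords x + w - coords y \in unit_ball.
Proof.
move=> xy wB mw; suff : (graph_ball (@lattice_adj 4) 1 y `&` code)
    (point (coords x + w)).
  by case=> /lattice_ball1; rewrite pointK -mem_unit_ball.
rewrite -xy; split; last by rewrite /code /mkset pointK.
by apply/lattice_ball1; rewrite pointK addrAC subrr add0r -mem_unit_ball.
Qed.

Lemma code_identifying : identifying_code (@lattice_adj 4) 1 code.
Proof.
have cover x : graph_ball (@lattice_adj 4) 1 x `&` code !=set0.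
  have [s sB ms] := marked_covers (coords x).
  exists (point (coords x + s)); split; last by rewrite /code /mkset pointK.
  by apply/lattice_ball1; rewrite pointK addrAC subrr add0r -mem_unit_ball.
split=> // [|x y xy Bxy]; first by have [z [_ Cz]] := cover 0; exists z.
have [s sB ms] := marked_covers (coords x).
(* The codeword [coords x + s] also lies in the ball of [y], and [t] is its offset from
   [coords y]. *)
have tB := code_ball_subset Bxy sB ms; set t := _ - coords y in tB.
have xyE : s - t = coords y - coords x.
  by rewrite /t [_ + s]addrC -addrA opprD opprB addNKr.
have st : s != t.
  rewrite -subr_eq0 xyE subr_eq0; apply/eqP => /(can_inj coordsK) yx.
  exact: xy.
have [w [[wB /negP ww mw]|[wB /negP ww mw]]] :=
  marked_separates (coords x) sB tB st; apply: ww; rewrite xyE.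
  by rewrite opprB addrCA addrA; exact: code_ball_subset Bxy wB mw.
rewrite addrCA addrA; apply: code_ball_subset (esym Bxy) wB _.
by move: mw; rewrite xyE addrA subrKC.
Qed.

(** * Counting codewords in a box *)

Lemma card_fset_set_le (X : choiceType) (T : finType) (A : set X) (f : X -> T) :
  finite_set A -> {in A &, injective f} -> (#|` fset_set A| <= #|T|)%N.
Proof.
move=> Afin finj; rewrite -(size_map f).
have /card_uniqP <- : uniq (map f (fset_set A)); last exact: max_card.
by rewrite map_inj_in_uniq// => x y; rewrite !in_fset_set//; exact: finj.
Qed.

Lemma leq_card_fset_set (X : choiceType) (T : finType) (A : set X)
    (f : T -> X) :
  finite_set A -> injective f -> (forall t, A (f t)) ->
  (#|T| <= #|` fset_set A|)%N.
Proof.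
move=> Afin finj fA; rewrite cardE -(size_map f); apply: uniq_leq_size.
  by rewrite map_inj_uniq// enum_uniq.
by move=> _ /mapP[t _ ->]; rewrite in_fset_set// inE.
Qed.

Lemma card_box n m : ((m + m).+1 ^ n <= #|` fset_set (box n m)|)%N.
Proof.
pose f (g : {ffun 'I_n -> 'I_(m + m).+1}) : {ffun 'I_n -> int} :=
  [ffun i => (g i)%:Z - m%:Z].
have <- : #|{ffun 'I_n -> 'I_(m + m).+1}| = ((m + m).+1 ^ n)%N.
  by rewrite card_ffun !card_ord.
apply: (@leq_card_fset_set _ _ _ f); first exact: finite_box.
  move=> g h /ffunP gh; apply/ffunP => i; apply/val_inj.
  by have := gh i; rewrite !ffunE => /addIr[].
by move=> g i; rewrite ffunE; case: (g i) => k km /=; move: km; clear; lia.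
Qed.

Lemma card_code_box m :
  (#|` fset_set (code `&` box 4 m)| <=
     ((m + m).+1 %/ 18).+1 * 4 * (m + m).+1 ^ 3)%N.
Proof.
set N := (m + m).+1.
pose shift (x : {ffun 'I_4 -> int}) i := absz (x (inord i) + m%:Z).
(* The last three coordinates and the residue of phi fix the first coordinate
   mod 18, so its quotient by 18 completes an injective encoding. *)
pose f x : 'I_(N %/ 18).+1 * 'I_4 * {ffun 'I_3 -> 'I_N} :=
  (inord (shift x 0%N %/ 18),
   inord (index (phi (coords x) %% 18)%Z marks),
   [ffun i : 'I_3 => inord (shift x i.+1)]).
have -> : ((N %/ 18).+1 * 4 * N ^ 3)%N =
    #|{: 'I_(N %/ 18).+1 * 'I_4 * {ffun 'I_3 -> 'I_N}}|.
  by rewrite !card_prod card_ffun !card_ord.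
apply: (@card_fset_set_le _ _ _ f); first exact/finite_setIr/finite_box.
(* These bounds, from membership in [code] and in the box, keep [inord] away from its default
   value. *)
have idx x : code x ->
    (index (phi (coords x) %% 18)%Z marks < 4)%N.
  by rewrite /code /mkset /marked -index_mem.
have shift_lt x i : box 4 m x -> (shift x i < N)%N.
  by move=> /(_ (inord i)); rewrite /shift /N; clear; lia.
have shift_inj x y i : box 4 m x -> box 4 m y -> shift x i = shift y i ->
    x (inord i) = y (inord i).
  by move=> /(_ (inord i)) + /(_ (inord i)); rewrite /shift /N; clear; lia.
move=> x y /set_mem[Cx Bx] /set_mem[Cy By] [] /(congr1 val) /= xy0.
move=> /(congr1 val) /= xyr /ffunP xy3.
have {}xy0 : (shift x 0 %/ 18 = shift y 0 %/ 18)%N.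
  by move: xy0; rewrite !inordK// ltnS leq_div2r// ltnW// shift_lt.
have {}xyr : (phi (coords x) %% 18)%Z = (phi (coords y) %% 18)%Z.
  by apply: (index_inj 0 Cx Cy); move: xyr; rewrite !inordK ?idx.
have xyi i : (i < 3)%N -> x (inord i.+1) = y (inord i.+1).
  move=> i3; have := xy3 (Ordinal i3); rewrite !ffunE => /(congr1 val) /=.
  by rewrite !inordK ?shift_lt//; exact: shift_inj.
apply: (can_inj coordsK).
have [x1 x2 x3] := And3 (xyi 0%N isT) (xyi 1%N isT) (xyi 2%N isT).
rewrite /coords x1 x2 x3; congr (_, _, _, _).
(* The first coordinates are now congruent mod 18. In the box both become nonnegative after adding
   [m], so equal quotients by 18 force equality. *)
move: xyr xy0 (Bx (inord 0)) (By (inord 0)).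
rewrite /coords /= x1 x2 x3 /shift; clear.
move: (x _) (y _) (y _) (y _) (y _) => a a' d c b; lia.
Qed.

(** * Passage to the limit *)

(** Every tail supremum of [u] is at most that of [v], and the upper limit of [v] is [l];
    convergence of [u] is never asked for. *)
Lemma limn_esup_le (R : realType) (u v : nat -> \bar R) (l : \bar R) :
  (forall n, u n <= v n)%E -> v @ \oo --> l -> (limn_esup u <= l)%E.
Proof.
move=> uv vl; have [_ <-] := cvg_limn_einf_sup vl.
apply: le_ereal_inf_tmp => _ [V Voo <-].
apply: ge_ereal_inf; exists (ereal_sup (u @` V)); first by exists V.
apply: ge_ereal_sup => _ [n Vn <-].
by apply: (le_trans (uv n)); apply: ereal_sup_ubound; exists n.
Qed.

Lemma code_density (R : realType) : (density R code <= (2 / 9)%:E)%E.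
Proof.
(* With N = 2m + 1, dividing (N / 18 + 1) * 4 * N^3 by N^4 gives 2/9 + 4/N. The error 4/N comes from
   the incomplete period, and N >= m + 1 bounds it by [4 * harmonic m]. *)
apply: (@limn_esup_le _ _ (fun m => (2 / 9 + 4 * harmonic m)%:E)) => [m|].
  rewrite lee_fin.
  have b0 : 0 < (#|` fset_set (box 4 m)|)%:R :> R.
    by rewrite ltr0n (leq_trans _ (card_box 4 m))// expn_gt0.
  rewrite ler_pdivrMr//.
  apply: (@le_trans _ _ ((2 / 9 + 4 * harmonic m) * ((m + m).+1 ^ 4)%:R));
    last first.
    by rewrite ler_wpM2l ?ler_nat ?card_box// addr_ge0// mulr_ge0// invr_ge0.
  apply: (@le_trans _ _ (((m + m).+1 %/ 18).+1 * 4 * (m + m).+1 ^ 3)%:R).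
    by rewrite ler_nat card_code_box.
  rewrite natrM (expnS _ 3) [in leRHS]natrM [leRHS]mulrA ler_wpM2r//.
  rewrite mulrDl -mulrA.
  have q18 : ((m + m).+1 %/ 18)%:R * 18 <= (m + m).+1%:R :> R.
    by rewrite -natrM ler_nat leq_divM.
  have hN : 1 <= harmonic m * (m + m).+1%:R :> R.
    by rewrite mulrC ler_pdivlMr// mul1r ler_nat ltnS leq_addl.
  by rewrite natrM -addn1 natrD; lra.
rewrite -[X in _ --> X%:E]addr0 -[X in _ + X](mulr0 4).
apply: cvg_EFin; first exact: nearW.
by apply: cvgD; [exact: cvg_cst|apply: cvgMl_tmp; exact: cvg_harmonic].
Qed.

Theorem theorem4 (R : realType) : (min_density R 4 1 <= (2 / 9)%:E)%E.
Proof.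
apply: ge_ereal_inf; exists (density R code); last exact: code_density.
by exists code => //; exact: code_identifying.
Qed.
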